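(* Let $G$ be a reflection group acting on $V\cong\mathbb{R}^n$ with the property that, for every $1\le l\le n$, every nonempty $l$-sparse $G$-invariant real variety intersects $\mathcal{H}_l(G)$. Let $1\le k\le n$, let $\pi_1,\dots,\pi_n$ be a set of basic invariants of $G$, let $S \subseteq V$ be a $k$-sparse semialgebraic set (i.e. $S$ is defined in terms of equations and inequalities with polynomials in $\mathbb{R}[\pi_1,\dots,\pi_k]$) and let $f \in \mathbb{R}[\pi_1,\dots,\pi_k]$. Then $f$ is nonnegative (respectively positive) on $S$ if and only if $f$ is nonnegative (respectively positive) on $\mathcal{H}_k(G) \cap S$.
   Context: A (real) reflection group $G$ acting on a Euclidean space $V \cong \mathbb{R}^n$ is a finite group of orthogonal transformations generated by reflections. Its reflection arrangement is the set of reflection hyperplanes of all reflections in $G$; flats are intersections of reflection hyperplanes (including $V$ itself), and $\mathcal{H}_i(G)$ is the set of points of $V$ contained in a flat of dimension $i$. A set of basic invariants $\pi_1,\dots,\pi_n$ is a set of $n$ algebraically independent homogeneous generators of the invariant ring $\mathbb{R}[V]^G$, labelled so that $\deg \pi_1\le\dots\le\deg\pi_n$. A $G$-invariant real variety $X\subseteq V$ (a set of common real zeros of polynomials) is $l$-sparse if it is the set of common real zeros of some $f_1,\dots,f_m\in\mathbb{R}[\pi_1,\dots,\pi_l]$, for some choice of basic invariants ordered by nondecreasing degree. *)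

(* Defs.v *)
From HB Require Import structures.
From mathcomp Require Export all_boot all_order all_algebra.
From mathcomp Require Export finmap classical_sets reals.
From mathcomp Require Export mpoly.

Set Implicit Arguments.
Unset Strict Implicit.
Unset Printing Implicit Defensive.

Import GRing.Theory Num.Theory.
Local Open Scope classical_set_scope.
Local Open Scope ring_scope.

(* The Euclidean space V is R^n with its standard inner product <u, v> = u v^T.
   Vectors are rows, and a matrix g acts on V by v |-> v *m g. *)

Section ReflectionGroups.
Variables (R : realType) (n : nat).
Implicit Types (G : {fset 'M[R]_n}) (s : 'M[R]_n) (X : set 'rV[R]_n).

(* v |-> v - 2 (<v, a> / <a, a>) a *)
Definition reflection (a : 'rV[R]_n) : 'M[R]_n :=
  1%:M - (2 / (a *m a^T) 0 0) *: (a^T *m a).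

Definition is_reflection s : Prop :=
  exists a : 'rV[R]_n, a != 0 /\ s = reflection a.

Record reflection_group G : Prop := ReflectionGroup {
  rg_one : 1%:M \in G;
  rg_mul : forall g h, g \in G -> h \in G -> g *m h \in G;
  rg_inv : forall g, g \in G -> invmx g \in G;
  rg_orth : forall g, g \in G -> g *m g^T = 1%:M;
  rg_gen : forall g, g \in G -> exists rs : seq 'M[R]_n,
    (forall r, r \in rs -> r \in G /\ is_reflection r) /\
    g = \big[mulmx/1%:M]_(r <- rs) r }.

(* The reflection hyperplane of s is the space of its fixed vectors. *)
Definition hyperplane s : 'M[R]_n := eigenspace s 1.

(* For ss = [::], this is V itself. *)
Definition flat (ss : seq 'M[R]_n) : 'M[R]_n :=
  (\bigcap_(s <- ss) hyperplane s)%MS.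

Definition flat_points G (i : nat) : set 'rV[R]_n :=
  [set v | exists ss : seq 'M[R]_n,
    [/\ forall s, s \in ss -> s \in G /\ is_reflection s,
        \rank (flat ss) = i & (v <= flat ss)%MS]].

Definition invariant_poly G (p : {mpoly R[n]}) : Prop :=
  forall g, g \in G -> forall v : 'rV[R]_n, p.@[(v *m g) 0] = p.@[v 0].

(* R[p_1, ..., p_m] for ps = [:: p_1; ...; p_m] *)
Definition subalgebra (ps : seq {mpoly R[n]}) : set {mpoly R[n]} :=
  [set p | exists q : {mpoly R[size ps]}, p = q \mPo in_tuple ps].

Definition alg_independent (ps : seq {mpoly R[n]}) : Prop :=
  forall q : {mpoly R[size ps]}, q \mPo in_tuple ps = 0 -> q = 0.

(* [msize] is the degree plus one on nonzero polynomials; the entries of an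
   algebraically independent family are nonzero. *)
Record basic_invariants G (pi : n.-tuple {mpoly R[n]}) : Prop :=
  BasicInvariants {
    bi_indep : alg_independent pi;
    bi_homog : forall i : 'I_n, exists d : nat, tnth pi i \is d.-homog;
    bi_gen : subalgebra pi = [set p | invariant_poly G p];
    bi_sorted : forall i j : 'I_n, (i <= j)%N ->
      (msize (tnth pi i) <= msize (tnth pi j))%N }.

Definition zeros (F : set {mpoly R[n]}) : set 'rV[R]_n :=
  [set v | forall p, F p -> p.@[v 0] = 0].

Definition real_variety X : Prop := exists F : set {mpoly R[n]}, X = zeros F.

Definition invariant_set G X : Prop :=
  forall g, g \in G -> forall v, X v -> X (v *m g).

Definition sparse G (l : nat) X : Prop :=
  exists2 pi : n.-tuple {mpoly R[n]}, basic_invariants G pi &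
    exists2 fs : seq {mpoly R[n]},
      (forall f, f \in fs -> subalgebra (take l pi) f) & X = zeros [set` fs].

(* [A] is meant to be a subalgebra: p >= 0 is then the complement of -p > 0. *)
Inductive semialgebraic (A : set {mpoly R[n]}) : set 'rV[R]_n -> Prop :=
| SemialgEq p : A p -> semialgebraic A [set v | p.@[v 0] = 0]
| SemialgPos p : A p -> semialgebraic A [set v | 0 < p.@[v 0]]
| SemialgC X : semialgebraic A X -> semialgebraic A (~` X)
| SemialgI X Y :
    semialgebraic A X -> semialgebraic A Y -> semialgebraic A (X `&` Y)
| SemialgU X Y :
    semialgebraic A X -> semialgebraic A Y -> semialgebraic A (X `|` Y).

Definition nonneg_on (f : {mpoly R[n]}) X : Prop :=
  forall v, X v -> 0 <= f.@[v 0].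

Definition pos_on (f : {mpoly R[n]}) X : Prop :=
  forall v, X v -> 0 < f.@[v 0].

End ReflectionGroups.

(* Main.v *)
Require Import Defs.

Set Implicit Arguments.
Unset Strict Implicit.
Unset Printing Implicit Defensive.

Import GRing.Theory.
Local Open Scope classical_set_scope.
Local Open Scope ring_scope.

(** Fix [v] in [S]. The common level set of pi_1, ..., pi_k through [v] is a
    nonempty k-sparse invariant variety, so it contains a point [w] of H_k(G).
    Every polynomial in R[pi_1, ..., pi_k] takes the same value at [v] and [w];
    hence [w] lies in [S] and f(w) = f(v). *)

Section Subalgebra.
Variables (R : realType) (n : nat).
Implicit Types (ps : seq {mpoly R[n]}) (p : {mpoly R[n]}) (v w : 'rV[R]_n).

Lemma mem_subalgebra ps p : p \in ps -> subalgebra ps p.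
Proof.
move=> /(tnthP (in_tuple ps)) [i ->]; exists 'X_i.
by rewrite comp_mpolyXU -tnth_nth.
Qed.

Lemma subalgebra_subC ps p (c : R) :
  subalgebra ps p -> subalgebra ps (p - c%:MP).
Proof.
by move=> [q ->]; exists (q - c%:MP); rewrite comp_mpolyB comp_mpolyC.
Qed.

(** An element of [subalgebra ps] is a polynomial in the entries of [ps], so its value at a point is
    determined by their values there. *)
Lemma meval_subalgebra ps v w :
  (forall p, p \in ps -> p.@[v 0] = p.@[w 0]) ->
  forall p, subalgebra ps p -> p.@[v 0] = p.@[w 0].
Proof.
move=> eq_vw p [q ->]; rewrite !comp_mpoly_meval; apply: meval_eq => i.
by apply: eq_vw; apply: mem_tnth.
Qed.

(** Induction on the construction of [S]. An equivalence is needed: each direction for a complement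
    uses the opposite direction for the set itself. *)
Lemma semialgebraic_meval (A : set {mpoly R[n]}) v w :
  (forall p, A p -> p.@[v 0] = p.@[w 0]) ->
  forall S, semialgebraic A S -> S v <-> S w.
Proof.
move=> eq_vw S; elim=> {S} [p Ap|p Ap|X _ IH|X Y _ IHX _ IHY|X Y _ IHX _ IHY] /=.
- by rewrite (eq_vw p Ap).
- by rewrite (eq_vw p Ap).
- by split=> nX /IH.
- by split=> -[/IHX ? /IHY ?].
- by split=> -[/IHX|/IHY]; [left|right|left|right].
Qed.

End Subalgebra.

Section LevelSet.
Variables (R : realType) (n : nat) (G : {fset 'M[R]_n}).
Variables (pi : n.-tuple {mpoly R[n]}) (hpi : basic_invariants G pi).
Variables (k : nat) (v : 'rV[R]_n).

(** Shifting by a constant makes [v] a common zero without leaving the subalgebra. *)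
Let fs := [seq p - (p.@[v 0])%:MP | p <- take k pi].

Definition level_set : set 'rV[R]_n := zeros [set` fs].

Lemma level_setP (w : 'rV[R]_n) :
  level_set w <-> forall p, p \in take k pi -> p.@[v 0] = p.@[w 0].
Proof.
split=> [w_fs p p_pi|eq_vw _ /mapP[p p_pi ->]].
  apply/esym/eqP; rewrite -subr_eq0; apply/eqP.
  have /w_fs : [set` fs] (p - (p.@[v 0])%:MP) by exact: map_f.
  by rewrite mevalB mevalC.
by rewrite mevalB mevalC -(eq_vw p p_pi) subrr.
Qed.

Lemma level_set_sparse : sparse G k level_set.
Proof.
exists pi => //; exists fs => // _ /mapP[p p_pi ->].
exact/subalgebra_subC/mem_subalgebra.
Qed.

Lemma level_set_invariant : invariant_set G level_set.
Proof.
move=> g Gg w /level_setP eq_vw; apply/level_setP => p p_pi.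
(* [bi_gen] concerns the full family [pi]; viewed in its subalgebra, [p] is seen to be
   [G]-invariant. *)
have : subalgebra pi p by exact/mem_subalgebra/(mem_take p_pi).
by rewrite (bi_gen hpi) => /(_ g Gg w) ->; apply: eq_vw.
Qed.

End LevelSet.

Theorem proposition4 (R : realType) (n : nat) (G : {fset 'M[R]_n})
    (hG : reflection_group G)
    (hsparse : forall l : nat, (1 <= l <= n)%N -> forall X : set 'rV[R]_n,
      real_variety X -> invariant_set G X -> sparse G l X ->
      X !=set0 -> X `&` flat_points G l !=set0)
    (k : nat) (hk : (1 <= k <= n)%N)
    (pi : n.-tuple {mpoly R[n]}) (hpi : basic_invariants G pi)
    (S : set 'rV[R]_n) (hS : semialgebraic (subalgebra (take k pi)) S)
    (f : {mpoly R[n]}) (hf : subalgebra (take k pi) f) :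
  (nonneg_on f S <-> nonneg_on f (flat_points G k `&` S)) /\
  (pos_on f S <-> pos_on f (flat_points G k `&` S)).
Proof.
have witness v : S v ->
    exists2 w, (flat_points G k `&` S) w & f.@[v 0] = f.@[w 0].
  move=> Sv.
  (* The family defining the level set itself witnesses [real_variety]; the remaining goal,
     nonemptiness, is met by [v]. *)
  have [|w [/level_setP eq_vw Hw]] := hsparse k hk (level_set pi k v)
      (ex_intro _ _ erefl) (@level_set_invariant _ _ _ _ hpi k v)
      (level_set_sparse hpi k v).
    by exists v; apply/level_setP.
  have eqA := meval_subalgebra eq_vw.
  exists w; last exact: eqA.
  by split=> //; apply/(semialgebraic_meval eqA hS).
(* Left to right is restriction to a subset; right to left moves [v] to its witness, where [f] has
   the same value, so both signs are handled alike. *)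
split; split=> f_on v.
- by case=> _; apply: f_on.
- by case/witness=> w /f_on ? ->.
- by case=> _; apply: f_on.
- by case/witness=> w /f_on ? ->.
Qed.
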